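(* Let $d\ge2$, $\Omega=\{0,1\}^{\mathbb{Z}^d}$, let $\mathbb{P}$ be the Bernoulli product measure with $\mathbb{P}(\sigma_0=1)=1/2$, and let $\mathbb{Q}$ be a stationary and ergodic Gibbs measure on $\Omega$, and assume the rate distortion function $\mathcal{R}(\varepsilon)=\mathcal{R}(\mathbb{Q},\mathbb{P},\varepsilon)$ is strictly positive on $[0,\varepsilon_0)$. Then for $\alpha\in(0,1)$ and $\varepsilon>0$ small enough with $\varepsilon/\alpha<\varepsilon_0$, there exist constants $\Lambda_1,\Lambda_2,C,c,K\in(0,\infty)$ and, for each $n$-pattern $A_n$, a number $\Lambda(A_n)\in[\Lambda_1,\Lambda_2]$ such that for every $t>0$, every $n\ge1$ and $\mathbb{Q}$-almost every $\omega$ (without requiring $\omega_{C_n}$ to be $(\varepsilon,\alpha)$-good), $$\left|\mathbb{P}\left(\mathbf{T}_{[\omega_{C_n}]^\varepsilon}>\frac{t}{\Lambda_n\,\mathbb{P}([\omega_{C_n}]^\varepsilon)}\right)-e^{-t}\right|\le C e^{-ct}e^{-Kn^d},\qquad \Lambda_n=\Lambda(\omega_{C_n}).$$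
   Context: For finite $V\subseteq\mathbb{Z}^d$, $\Delta(V,\eta,\sigma)=\sum_{x\in V}|\eta_x-\sigma_x|$. $C_n=[0,n]^d\cap\mathbb{Z}^d$. An $n$-pattern is a map $A_n:C_n\to\{0,1\}$, and $[A_n]^\varepsilon=\{\omega\in\Omega:\Delta(C_n,\omega,A_n)\le\varepsilon|C_n|\}$. Approximate hitting time: $\mathbf{T}_{[A_n]^\varepsilon}(\sigma)=\min\{|C_k|:k>0,\ \exists x\in\mathbb{Z}^d,\ C_n+x\subseteq C_k,\text{ and the restriction of }\sigma\text{ to }C_n+x\text{, translated to }C_n\text{, lies in }[A_n]^\varepsilon\}$. An $n$-pattern $A_n$ is $(\varepsilon,\alpha)$-good if $[A_n]^\varepsilon$ and its translate by $x$ are disjoint for all $0<|x|\le\alpha n$. Rate distortion function: $\mathcal{R}(\mathbb{Q},\mathbb{P},\varepsilon)=\lim_n\inf_{\mathbb{J}_n}\frac{1}{|C_n|}H(\mathbb{J}_n\|\mathbb{Q}_n\times\mathbb{P}_n)$, infimum over joint distributions $\mathbb{J}_n$ on $\{0,1\}^{C_n}\times\{0,1\}^{C_n}$ with first marginal $\mathbb{Q}_n$ (the $C_n$-marginal of $\mathbb{Q}$) and $\int\frac{\Delta(C_n,\omega,\sigma)}{|C_n|}d\mathbb{J}_n\le\varepsilon$; $H$ is relative entropy. *)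

(* Defs.v *)
From HB Require Import structures.
From mathcomp Require Import all_boot all_order all_algebra.
From mathcomp Require Import finmap.
From mathcomp Require Import all_classical all_reals all_analysis.

Set Implicit Arguments.
Unset Strict Implicit.
Unset Printing Implicit Defensive.
Import Order.TTheory GRing.Theory Num.Theory.
Import numFieldNormedType.Exports.

Local Open Scope classical_set_scope.
Local Open Scope ring_scope.

Section Lattice.
Variable d : nat.

Definition site := {ffun 'I_d -> int}.
Definition origin : site := [ffun=> 0].
Definition addsite (x y : site) : site := [ffun i => x i + y i].

Definition config := site -> bool.

Definition cyl : set (set config) :=
  [set A | exists (x : site) (b : bool), A = [set w : config | w x = b]].
Definition Omega := g_sigma_algebraType cyl.

Definition shift_cfg (x : site) (w : config) : config := fun y => w (addsite y x).

Definition box (n : nat) := {ffun 'I_d -> 'I_n.+1}.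
Definition card_box (n : nat) : nat := (n.+1 ^ d)%N.
Definition pattern (n : nat) := {ffun box n -> bool}.
Definition shift_pt (n : nat) (x : site) (y : box n) : site :=
  [ffun i => x i + ((y i : nat)%:Z)].
Definition in_box (k : nat) (p : site) : Prop :=
  forall i, 0 <= p i /\ p i <= (k%:Z).

Definition restr (n : nat) (x : site) (w : config) : pattern n :=
  [ffun y => w (shift_pt x y)].
Arguments restr n x w : clear implicits.

Definition Delta (n : nat) (a b : pattern n) : nat :=
  (\sum_(y : box n) `|(a y : nat)%:Z - (b y : nat)%:Z|%N)%N.

Section Real.
Variable R : realType.

Definition approx_pat (n : nat) (A : pattern n) (eps : R) : set (pattern n) :=
  [set a | (Delta a A)%:R <= eps * (card_box n)%:R].

Definition approx_set (n : nat) (A : pattern n) (eps : R) : set config :=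
  [set w | approx_pat A eps (restr n origin w)].

(* approximate hitting time (= +oo when there is no occurrence) *)
Definition hit (n : nat) (A : pattern n) (eps : R) (s : config) : \bar R :=
  ereal_inf [set ((card_box k)%:R)%:E | k in
    [set k : nat | (0 < k)%N /\
       exists x : site, (forall y : box n, in_box k (shift_pt x y)) /\
                        approx_pat A eps (restr n x s)]].

Definition bernoulli_half (P : probability Omega R) : Prop :=
  forall (V : {fset site}) (b : site -> bool),
    P [set w : config | forall x, x \in V -> w x = b x] = ((2^-1) ^+ #|` V|)%:E.

Definition stationary (Q : probability Omega R) : Prop :=
  forall (x : site) (B : set Omega), measurable B ->
    Q (shift_cfg x @^-1` B) = Q B.

Definition ergodic (Q : probability Omega R) : Prop :=
  forall B : set Omega, measurable B ->
    (forall x : site, shift_cfg x @^-1` B = B) -> Q B = 0%E \/ Q B = 1%E.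

Definition potential := {fset site} -> config -> R.

Definition local (A : {fset site}) (f : config -> R) : Prop :=
  forall w w' : config, (forall x, x \in A -> w x = w' x) -> f w = f w'.

Definition transl_set (x : site) (A : {fset site}) : {fset site} :=
  [fset addsite y x | y in A]%fset.

Definition ball (m : nat) : {fset site} :=
  [fset shift_pt ([ffun=> - (m%:Z)]) y | y in enum (box (m + m))]%fset.

Definition ti_summable_potential (Phi : potential) : Prop :=
  [/\ forall A, local A (Phi A),
      forall A x w, Phi (transl_set x A) w = Phi A (shift_cfg x w) &
      exists c : {fset site} -> R, (forall A w, `|Phi A w| <= c A) /\
        exists M : R, forall m,
          \sum_(A <- fpowerset (ball m) | origin \in A) c A <= M].

Definition hamiltonian (Phi : potential) (L : {fset site}) (w : config) : R :=
  limn (fun m => \sum_(A <- fpowerset (ball m) | (A `&` L)%fset != fset0) Phi A w).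

Definition glue (L S : {fset site}) (w : config) : config :=
  fun y => if y \in L then y \in S else w y.

Definition gamma (Phi : potential) (L : {fset site}) (B : set config) (w : config) : R :=
  (\sum_(S <- fpowerset L)
       \1_B (glue L S w) * expR (- hamiltonian Phi L (glue L S w))) /
  (\sum_(S <- fpowerset L) expR (- hamiltonian Phi L (glue L S w))).

Definition gibbs (Q : probability Omega R) : Prop :=
  exists Phi : potential, ti_summable_potential Phi /\
    forall (L : {fset site}) (B : set Omega), measurable B ->
      Q B = (\int[Q]_w (gamma Phi L B w)%:E)%E.

Definition marg (mu : probability Omega R) (n : nat) (a : pattern n) : R :=
  fine (mu [set w : config | restr n origin w = a]).
Arguments marg mu n a : clear implicits.

Definition relent (T : finType) (J m : T -> R) : R :=
  \sum_(z : T) (if J z == 0 then 0 else J z * ln (J z / m z)).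

Definition coupling (Q : probability Omega R) (n : nat) (eps : R)
  (J : pattern n * pattern n -> R) : Prop :=
  [/\ forall z, 0 <= J z,
      forall a, \sum_(b : pattern n) J (a, b) = marg Q n a &
      \sum_(z : pattern n * pattern n) J z * ((Delta z.1 z.2)%:R / (card_box n)%:R)
        <= eps].
Arguments coupling Q n eps J : clear implicits.

Definition rate_distortion_n (Q P : probability Omega R) (eps : R) (n : nat) : R :=
  inf [set relent J (fun z => marg Q n z.1 * marg P n z.2) / (card_box n)%:R
      | J in [set J | coupling Q n eps J]].

Definition rate_distortion (Q P : probability Omega R) (eps : R) : R :=
  limn (rate_distortion_n Q P eps).

End Real.
End Lattice.

(* Main.v *)
Require Import Defs.
From HB Require Import structures.
From mathcomp Require Import all_boot all_order all_algebra.
From mathcomp Require Import zify ring lra.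
From mathcomp Require Import finmap.
From mathcomp Require Import all_classical all_reals all_analysis.
Import Order.TTheory GRing.Theory Num.Theory.
Import numFieldNormedType.Exports.
Set Implicit Arguments.
Unset Strict Implicit.
Unset Printing Implicit Defensive.
Local Open Scope ring_scope.

(**
  For [eps] small the estimate holds for every pattern [A], hence for every
  [w], and only the product structure of [P] enters.

  Let [p_A] be the probability of the Hamming ball of radius [eps * N] around
  [A], where [N = (n+1)^d]; it is exponentially small in [N]. Two overlapping
  windows at different positions are both close to [A] with probability at most
  [2 (6/7)^(n+1) p_A]: one window contains a segment of [n + 1] sites outside
  the other (this is where [d >= 2] is used), and on it either few mismatches
  occur, which is an independent and unlikely event, or many do, and then the
  exponential growth of small Hamming balls gives the bound. Fix a side
  [L = exp (const * N)] so small that [p_A * L^(2d) <= 1]. By the second moment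
  method the probability [p] of an occurrence among [L^d] positions is
  comparable with [p_A * L^d], and [Lambda(A)] is defined by
  [1 - p = exp (- Lambda(A) * p_A * L^d)].

  Tiling a box of side [j] by boxes of side [L + n], in which the occurrences
  are independent, gives [P (no occurrence) = exp (- t)] up to an error
  [O ((1 + t) * n / L)], together with a tail bound [O (exp (- c t))]. The
  geometric mean of these two estimates is the theorem.
*)

(** * Uniform measure on finite binary configurations *)

Definition pull (S T : finType) (h : S -> T) (s : {ffun T -> bool}) :
  {ffun S -> bool} := [ffun x => s (h x)].

Definition dist (S : finType) (a b : {ffun S -> bool}) : nat :=
  #|[set x | a x != b x]|.

Definition ball_card (N i : nat) : nat := (\sum_(j < i.+1) 'C(N, j))%N.

(* If an eighth of [m] sites are mismatches, this growth per mismatch contributes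
   [4 ^ m], which outweighs the [2 ^ m] values of the configuration there. *)
Definition growth_ratio : nat := 4 ^ 8.

Section Uniform.
Variable R : realFieldType.

(** The fair coin law on a finite set [T] of sites, as a normalised count, so that the combinatorial
    estimates need no measure theory. *)
Definition pr (T : finType) (E : pred {ffun T -> bool}) : R :=
  #|[set s | E s]|%:R / 2 ^+ #|T|.

Lemma pr_sum (T : finType) (E : pred {ffun T -> bool}) :
  pr E = (\sum_s (E s)%:R) / 2 ^+ #|T|.
Proof.
rewrite /pr -sum1dep_card natr_sum big_mkcond; congr (_ / _).
by apply: eq_bigr => s _; case: (E s).
Qed.

Lemma pr_ge0 (T : finType) (E : pred {ffun T -> bool}) : 0 <= pr E.
Proof. by rewrite divr_ge0 ?exprn_ge0. Qed.

Lemma pr_ext (T : finType) (E F : pred {ffun T -> bool}) : E =1 F -> pr E = pr F.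
Proof. by move=> EF; rewrite !pr_sum; congr (_ / _); apply: eq_bigr => s _; rewrite EF. Qed.

Lemma pr_le (T : finType) (E F : pred {ffun T -> bool}) :
  (forall s, E s -> F s) -> pr E <= pr F.
Proof.
move=> EF; rewrite ler_wpM2r ?invr_ge0 ?exprn_ge0 // ler_nat.
by apply: subset_leq_card; apply/fintype.subsetP => s; rewrite !inE; apply: EF.
Qed.

Lemma pr_true (T : finType) : pr (fun _ : {ffun T -> bool} => true) = 1.
Proof.
rewrite /pr (_ : [set s | true] = finset.setT); last by apply/setP => s; rewrite !inE.
by rewrite cardsT card_ffun card_bool natrX divff // expf_neq0 // pnatr_eq0.
Qed.

Lemma pr_not (T : finType) (E : pred {ffun T -> bool}) :
  pr (fun s => ~~ E s) = 1 - pr E.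
Proof.
rewrite -(pr_true T) !pr_sum -mulrBl -sumrB; congr (_ / _).
by apply: eq_bigr => s _; case: (E s); rewrite ?subrr ?subr0.
Qed.

Lemma pr_le1 (T : finType) (E : pred {ffun T -> bool}) : pr E <= 1.
Proof. by rewrite -(pr_true T); apply: pr_le. Qed.

Lemma pr_or (T : finType) (E F : pred {ffun T -> bool}) :
  pr (fun s => E s || F s) <= pr E + pr F.
Proof.
rewrite !pr_sum -mulrDl -big_split ler_wpM2r ?invr_ge0 ?exprn_ge0 //.
by apply: ler_sum => s _; case: (E s); case: (F s); rewrite /= ?lexx ?addr0 ?add0r //; lra.
Qed.

Lemma pr_exists_in (T I : finType) (A : pred I) (E : I -> pred {ffun T -> bool}) :
  pr (fun s => [exists x, A x && E x s]) <= \sum_(x | A x) pr (E x).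
Proof.
under eq_bigr do rewrite pr_sum.
rewrite -mulr_suml pr_sum ler_wpM2r ?invr_ge0 ?exprn_ge0 //.
rewrite exchange_big; apply: ler_sum => s _ /=.
have [/existsP[x /andP[Ax Ex]]|_] := boolP [exists x, A x && E x s]; last exact: sumr_ge0.
by rewrite (bigD1 x) //= Ex lerDl sumr_ge0.
Qed.

(** Let [N] be the number of the events that hold. Where [N] is positive, [0 <= (M - N) ^+ 2] gives
    [2 * M * N - N ^+ 2 <= M ^+ 2], and elsewhere the left side vanishes. Averaging, and bounding
    the mean of [N ^+ 2] by [M] times that of [N], gives the claim. *)
Lemma second_moment (T I : finType) (E : I -> pred {ffun T -> bool}) (M : R) :
  0 < M ->
  (forall x, \sum_y pr (fun s => E x s && E y s) <= M * pr (E x)) ->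
  \sum_x pr (E x) <= M * pr (fun s => [exists x, E x s]).
Proof.
move=> M0 HM; rewrite -(ler_pM2l M0).
suff : 2 * M * (\sum_x pr (E x)) - \sum_x \sum_y pr (fun s => E x s && E y s)
    <= M ^+ 2 * pr (fun s => [exists x, E x s]).
  have : \sum_x \sum_y pr (fun s => E x s && E y s) <= M * \sum_x pr (E x).
    by rewrite mulr_sumr; apply: ler_sum => x _; apply: HM.
  by rewrite expr2 -mulrA; lra.
under eq_bigr do rewrite pr_sum.
under [X in _ - X]eq_bigr do under eq_bigr do rewrite pr_sum.
under [X in _ - X]eq_bigr do rewrite -mulr_suml.
rewrite -!mulr_suml pr_sum !mulrA -mulrBl ler_wpM2r ?invr_ge0 ?exprn_ge0 //.
rewrite exchange_big /=.
under [X in _ - X]eq_bigr do rewrite exchange_big /=.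
rewrite [X in _ - X]exchange_big /=.
rewrite !mulr_sumr -sumrB; apply: ler_sum => s _.
set N := \sum_x (E x s)%:R.
have -> : \sum_x \sum_y (E x s && E y s)%:R = N ^+ 2 :> R.
  rewrite expr2 mulr_suml; apply: eq_bigr => x _; rewrite mulr_sumr.
  by apply: eq_bigr => y _; case: (E x s); rewrite ?mul1r ?mul0r.
have [_|/existsPn noE] := boolP [exists x, E x s].
  by have := sqr_ge0 (M - N); rewrite sqrrB /= mulr1; lra.
have -> : N = 0 by rewrite /N big1 // => x _; rewrite (negPf (noE x)).
by rewrite !mulr0 expr0n subr0.
Qed.

(** All fibres have the same size: adding modulo 2 the difference of [b] and [c], extended by zero
    off the range of [h], maps the fibre over [b] injectively into the fibre over [c]. *)
Lemma card_fiber (S T : finType) (h : S -> T) (a : {ffun S -> bool}) :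
  injective h -> (#|[set s | pull h s == a]| * 2 ^ #|S| = 2 ^ #|T|)%N.
Proof.
move=> hI.
pose ext (e : {ffun S -> bool}) : {ffun T -> bool} :=
  [ffun t => [exists x, (h x == t) && e x]].
have extE e x : ext e (h x) = e x.
  rewrite ffunE; apply/existsP/idP => [[y /andP[/eqP/hI<- //]]|ex].
  by exists x; rewrite eqxx ex.
have fib_le b c : (#|[set s | pull h s == b]| <= #|[set s | pull h s == c]|)%N.
  pose f (s : {ffun T -> bool}) : {ffun T -> bool} :=
    [ffun t => s t (+) ext [ffun x => b x (+) c x] t].
  have fI : injective f.
    move=> s s' /ffunP ss; apply/ffunP => t; move: (ss t); rewrite !ffunE.
    exact: addIb.
  rewrite -(card_imset _ fI); apply: subset_leq_card.
  apply/fintype.subsetP => _ /imsetP[s + ->]; rewrite !inE => /eqP/ffunP sb.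
  apply/eqP/ffunP => x; move: (sb x); rewrite !ffunE => sbx.
  have := extE [ffun x => b x (+) c x] x; rewrite !ffunE => ->.
  by rewrite sbx addbA addbb.
have -> : (2 ^ #|T| = #|{: {ffun T -> bool}}|)%N by rewrite card_ffun card_bool.
have -> : (2 ^ #|S| = #|{: {ffun S -> bool}}|)%N by rewrite card_ffun card_bool.
rewrite -[RHS]sum1_card (partition_big (pull h) predT) //= mulnC -sum_nat_const.
apply: eq_bigr => b _; rewrite sum1dep_card.
by apply/eqP; rewrite eqn_leq !fib_le.
Qed.

Lemma pr_pull (S T : finType) (h : S -> T) (E : pred {ffun S -> bool}) :
  injective h -> pr (fun s => E (pull h s)) = pr E.
Proof.
move=> hI; rewrite /pr.
have -> : #|[set s | E (pull h s)]| =
    (\sum_(a in [set a | E a]) #|[set s | pull h s == a]|)%N.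
  rewrite -sum1_card (partition_big (pull h) (mem [set a | E a])) /=; last first.
    by move=> s; rewrite !inE.
  apply: eq_bigr => a; rewrite inE => Ea; rewrite -sum1dep_card.
  by apply: eq_bigl => s; rewrite !inE; case: eqP => [->|]; rewrite ?Ea ?andbF.
rewrite natr_sum; apply: (@mulIf _ (2 ^+ #|T|)); first by rewrite expf_neq0 ?pnatr_eq0.
rewrite mulfVK ?expf_neq0 ?pnatr_eq0 //.
apply: (@mulIf _ (2 ^+ #|S|)); first by rewrite expf_neq0 ?pnatr_eq0.
rewrite mulrAC mulfVK ?expf_neq0 ?pnatr_eq0 // mulr_suml.
under eq_bigr do rewrite -natrX -natrM card_fiber //.
by rewrite sumr_const natrX mulr_natl.
Qed.

Lemma pr_indep2 (S1 S2 T : finType) (h1 : S1 -> T) (h2 : S2 -> T)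
    (E1 : pred {ffun S1 -> bool}) (E2 : pred {ffun S2 -> bool}) :
  injective h1 -> injective h2 -> (forall x y, h1 x != h2 y) ->
  pr (fun s => E1 (pull h1 s) && E2 (pull h2 s)) = pr E1 * pr E2.
Proof.
move=> h1I h2I h12.
pose h (x : S1 + S2) := match x with inl x => h1 x | inr x => h2 x end.
have hI : injective h.
  move=> [x|x] [y|y] /= => [/h1I->//|/eqP|/esym/eqP|/h2I->//].
  - by rewrite (negPf (h12 _ _)).
  - by rewrite (negPf (h12 _ _)).
pose E (a : {ffun S1 + S2 -> bool}) := E1 (pull inl a) && E2 (pull inr a).
rewrite -(@pr_ext _ (fun s => E (pull h s))); last first.
  move=> s; rewrite /E; congr (E1 _ && E2 _); apply/ffunP => x; by rewrite !ffunE.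
rewrite pr_pull // /pr card_sum exprD invfM mulrACA -natrM -cardsX.
congr (_%:R * _).
pose f (a : {ffun S1 + S2 -> bool}) := (pull inl a, pull inr a).
have fI : injective f.
  move=> a b [/ffunP e1 /ffunP e2]; apply/ffunP => -[x|x].
  - by move: (e1 x); rewrite !ffunE.
  - by move: (e2 x); rewrite !ffunE.
rewrite -(card_imset _ fI); apply: eq_card => -[a b]; rewrite !inE /=.
apply/imsetP/andP => [[c]|[Ea Eb]]; first by rewrite inE => /andP[? ?] [-> ->].
have ea : pull inl [ffun x : S1 + S2 => match x with inl x => a x | inr x => b x end] = a.
  by apply/ffunP => x; rewrite !ffunE.
have eb : pull inr [ffun x : S1 + S2 => match x with inl x => a x | inr x => b x end] = b.
  by apply/ffunP => x; rewrite !ffunE.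
by exists [ffun x : S1 + S2 => match x with inl x => a x | inr x => b x end];
  rewrite ?inE /E /f ea eb ?Ea.
Qed.

(** Joint injectivity says that each [g i] is injective and that their ranges are pairwise disjoint.
    After pulling back to [I * S], the event consists of all families indexed by [I] of elements of
    [E]. *)
Lemma pr_indep (I S T : finType) (g : I -> S -> T) (E : pred {ffun S -> bool}) :
  injective (fun u : I * S => g u.1 u.2) ->
  pr (fun s => [forall i, E (pull (g i) s)]) = pr E ^+ #|I|.
Proof.
move=> gI.
pose F (a : {ffun I * S -> bool}) := [forall i, E (pull (pair i) a)].
rewrite -(@pr_ext _ (fun s => F (pull (fun u : I * S => g u.1 u.2) s))); last first.
  move=> s; rewrite /F; apply: eq_forallb => i; congr (E _).
  by apply/ffunP => x; rewrite !ffunE.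
rewrite pr_pull // /pr expr_div_n card_prod (mulnC #|I|) exprM -[_%:R ^+ #|I|]natrX.
congr (_%:R / _).
pose f (a : {ffun I * S -> bool}) := [ffun i => pull (pair i) a].
have fI : injective f.
  move=> a b /ffunP ab; apply/ffunP => -[i x].
  by move: (ab i); rewrite !ffunE => /ffunP/(_ x); rewrite !ffunE.
rewrite -(card_ffun_on _ (mem [set a | E a])) -(card_imset _ fI).
apply: eq_card => a; rewrite [RHS]inE; apply/imsetP/ffun_onP => [[b]|Ha].
  by rewrite inE => /forallP Fb -> i; rewrite ffunE inE.
have aE i : pull (pair i) [ffun u : I * S => a u.1 u.2] = a i.
  by apply/ffunP => x; rewrite !ffunE.
exists [ffun u : I * S => a u.1 u.2].
  by rewrite inE; apply/forallP => i; rewrite aE; have := Ha i; rewrite inE.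
by apply/ffunP => i; rewrite ffunE aE.
Qed.

(** * Hamming balls and overlapping copies of a pattern *)

Lemma card_ball (S : finType) (i : nat) :
  #|[set D : {set S} | (#|D| <= i)%N]| = ball_card #|S| i.
Proof.
rewrite -sum1dep_card /ball_card.
rewrite (partition_big (fun D : {set S} => inord #|D| : 'I_i.+1) predT) //=.
apply: eq_bigr => j _; rewrite sum1dep_card -card_draws; apply: eq_card => D.
rewrite !inE; apply/andP/eqP => [[Di /eqP<-]|Dj]; first by rewrite inordK.
by rewrite Dj -ltnS ltn_ord; split=> //; apply/eqP/val_inj; rewrite /= inordK.
Qed.

(** A configuration and its set of mismatches with [A] determine each other, so the mismatch set is
    uniform among the subsets of [S], whatever [A] is. *)
Lemma pr_diffset (S : finType) (A : {ffun S -> bool}) (E : pred {set S}) :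
  pr (fun a => E [set x | a x != A x]) = #|[set D | E D]|%:R / 2 ^+ #|S|.
Proof.
rewrite /pr; congr (_%:R / _).
pose f (a : {ffun S -> bool}) := [set x | a x != A x].
have fI : injective f.
  move=> a b /setP ab; apply/ffunP => x; move: (ab x); rewrite !inE.
  by case: (a x); case: (b x); case: (A x).
rewrite -(card_imset _ fI); apply: eq_card => D; rewrite [RHS]inE.
apply/imsetP/idP => [[a]|ED]; first by rewrite inE => Ea ->.
have e : [set x | [ffun x => A x (+) (x \in D)] x != A x] = D.
  by apply/setP => x; rewrite inE ffunE; case: (A x); case: (x \in D).
by exists [ffun x => A x (+) (x \in D)]; rewrite ?inE /f e.
Qed.

Lemma pr_dist (S : finType) (A : {ffun S -> bool}) (r : nat) :
  pr (fun a => (dist a A <= r)%N) = (ball_card #|S| r)%:R / 2 ^+ #|S|.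
Proof. by rewrite (pr_diffset A (fun D : {set S} => (#|D| <= r)%N)) card_ball. Qed.

(* Markov's inequality for 2^(-|D|). *)
Lemma ball_card_chernoff (N q : nat) : (8 * q <= N)%N ->
  (ball_card N q)%:R / 2 ^+ N <= (6 / 7) ^+ N :> R.
Proof.
move=> qN; rewrite ler_pdivrMr ?exprn_gt0 // -exprMn.
(* The power [(3 / 2) ^+ N] is the sum of all ['C(N, j) / 2 ^+ j]. The power [(8 / 7) ^+ N] pays for
   the loss [2 ^+ q], as [2 <= (8 / 7) ^+ 8] and [8 * q <= N]. *)
have -> : 6 / 7 * 2 = (8 / 7) * (3 / 2) :> R by field.
rewrite exprMn.
apply: (@le_trans _ _ (2 ^+ q * (3 / 2) ^+ N)); last first.
  apply: ler_wpM2r; first by rewrite exprn_ge0 ?divr_ge0.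
  apply: (@le_trans _ _ ((8 / 7) ^+ (8 * q))); last by rewrite ler_weXn2l //; lra.
  by rewrite exprM lerXn2r // ?nnegrE; lra.
have -> : 3 / 2 = 1 + 2^-1 :> R by field.
rewrite [X in _ * X]exprDn mulr_sumr /ball_card natr_sum.
have qN' : (q.+1 <= N.+1)%N by lia.
rewrite (big_ord_widen _ (fun j => 'C(N, j)%:R) qN') big_mkcond /=.
apply: ler_sum => i _; rewrite expr1n mul1r.
case: ifP => iq; last by rewrite mulr_ge0 ?exprn_ge0 // mulrn_wge0 // exprn_ge0 // invr_ge0.
rewrite -[X in _ * X]mulr_natr mulrA; apply: ler_peMl => //.
by rewrite exprVn ler_pdivlMr ?exprn_gt0 // mul1r ler_weXn2l // ler1n.
Qed.

(** Consecutive binomial coefficients have ratio [(N - j) / j.+1], which is at least [rho] as long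
    as [rho.+1 * j.+1 <= N]. Each unit of radius thus gains a factor [rho]. *)
Lemma ball_card_growth (N rho i k : nat) : (rho.+1 * (i + k) <= N)%N ->
  (rho ^ k * ball_card N i <= ball_card N (i + k))%N.
Proof.
elim: k => [|k IH] H; first by rewrite addn0 expn0 mul1n.
have H' : (rho.+1 * (i + k) <= N)%N by nia.
rewrite addnS expnS -mulnA; apply: (leq_trans (leq_mul (leqnn rho) (IH H'))).
rewrite /ball_card [leqRHS]big_ord_recl; apply: leq_trans (leq_addl _ _).
rewrite big_distrr; apply: leq_sum => -[j /= jik] _; rewrite /bump /= add1n.
rewrite -(leq_pmul2r (ltn0Sn j)) [leqRHS]mulnC mul_bin_left.
by rewrite mulnAC leq_mul2r; apply/orP; right; nia.
Qed.

(* Either the copy of [A] read along [g2] is close to [A] on the part [f] that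
   [g1] does not see, which is unlikely and independent of what [g1] sees; or
   almost all its allowed mismatches lie outside [f], and then the exponential
   growth of Hamming balls beats the [2 ^ #|K|] values left free on [f]. *)
Lemma pr_overlap (K S T : finType) (f : K -> S) (g1 g2 : S -> T)
    (A : {ffun S -> bool}) (r : nat) :
  injective f -> injective g1 -> injective g2 ->
  (forall x y, g1 x != g2 (f y)) -> (growth_ratio.+1 * r <= #|S|)%N ->
  pr (fun s => (dist (pull g1 s) A <= r)%N && (dist (pull g2 s) A <= r)%N) <=
    2 * (6 / 7) ^+ #|K| * pr (fun a => (dist a A <= r)%N).
Proof.
move=> fI g1I g2I g12 rS; set q := (#|K| %/ 8)%N; set PA := pr (fun a : {ffun S -> bool} => _).
pose F := f @: [set: K].
have cF : #|F| = #|K| by rewrite card_imset // cardsT.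
pose E1 (s : {ffun T -> bool}) := (dist (pull g1 s) A <= r)%N &&
  (dist (pull (g2 \o f) s) (pull f A) <= q)%N.
pose E2 (s : {ffun T -> bool}) :=
  (#|[set x | pull g2 s x != A x] :\: F| + q.+1 <= r)%N.
apply: (@le_trans _ _ (pr E1 + pr E2)).
  apply: le_trans (pr_or _ _); apply: pr_le => s /andP[d1 d2].
  rewrite /E1 /E2 d1 /=; case: leqP => //= qd; apply: leq_trans d2.
  rewrite /dist -(cardsID F [set x | pull g2 s x != A x]) addnC leq_add2r.
  apply: leq_trans qd _; rewrite /dist -(card_imset _ fI); apply: subset_leq_card.
  apply/fintype.subsetP => _ /imsetP[x + ->]; rewrite !inE !ffunE => xN.
  by rewrite xN imset_f.
have h1 : pr E1 <= (6 / 7) ^+ #|K| * PA.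
  rewrite /E1 (pr_indep2 (fun a => (dist a A <= r)%N)
    (fun a => (dist a (pull f A) <= q)%N) g1I (inj_comp g2I fI)) //.
  by rewrite mulrC ler_wpM2r ?pr_ge0 // pr_dist ball_card_chernoff // mulnC leq_divM.
suff h2 : pr E2 <= (6 / 7) ^+ #|K| * PA by move: h1 h2; lra.
rewrite /E2 (pr_pull (fun a : {ffun S -> bool} =>
  (#|[set x | a x != A x] :\: F| + q.+1 <= r)%N) g2I).
rewrite (pr_diffset A (fun D : {set S} => (#|D :\: F| + q.+1 <= r)%N)).
rewrite /PA pr_dist mulrA ler_wpM2r ?invr_ge0 ?exprn_ge0 //.
have [qr|qr] := leqP q.+1 r; last first.
  have -> : [set D : {set S} | (#|D :\: F| + q.+1 <= r)%N] = finset.set0.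
    by apply/setP => D; rewrite !inE; apply/negbTE; lia.
  by rewrite cards0 mulr_ge0 // exprn_ge0 //; lra.
have cE : (#|[set D : {set S} | (#|D :\: F| + q.+1 <= r)%N]| <=
    2 ^ #|K| * ball_card #|S| (r - q.+1))%N.
  rewrite -cF -card_powerset -card_ball -cardsX.
  (* A set [D] splits into an arbitrary subset of [F] and a set of at most [r - q.+1] points outside
     [F]. *)
  pose sp (D : {set S}) := (D :&: F, D :\: F).
  have spI : injective sp.
    by move=> D D' [e1 e2]; rewrite -(finset.setID D F) e1 e2 finset.setID.
  rewrite -(card_imset _ spI); apply: subset_leq_card.
  by apply/fintype.subsetP => _ /imsetP[D + ->]; rewrite !inE /= finset.subsetIr; lia.
have := @ball_card_growth #|S| growth_ratio (r - q.+1) q.+1.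
rewrite subnK // => /(_ rS) gr.
have q8 : (#|K| <= 8 * q.+1)%N by rewrite mulnC; apply/ltnW/ltn_ceil.
have gr4 : (4 ^ #|K| * ball_card #|S| (r - q.+1) <= ball_card #|S| r)%N.
  apply: leq_trans gr; rewrite /growth_ratio -expnM leq_mul2r; apply/orP; right.
  exact: leq_pexp2l.
have : (2 ^ #|K| * #|[set D : {set S} | (#|D :\: F| + q.+1 <= r)%N]| <=
    ball_card #|S| r)%N.
  apply: leq_trans gr4; rewrite (_ : 4 = 2 * 2)%N // expnMn -mulnA leq_mul2l.
  by rewrite cE orbT.
rewrite -(ler_nat R) natrM natrX => H.
apply: (@le_trans _ _ ((1 / 2) ^+ #|K| * (ball_card #|S| r)%:R)); last first.
  by rewrite ler_wpM2r // lerXn2r ?nnegrE //; lra.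
by rewrite div1r exprVn mulrC ler_pdivlMr ?exprn_gt0 // mulrC.
Qed.

End Uniform.

(** * Windows and occurrences in a finite cube *)

Definition cube (d M : nat) := {ffun 'I_d -> 'I_M}.

Lemma card_cube (d M : nat) : #|{: cube d M}| = (M ^ d)%N.
Proof. by rewrite card_ffun !card_ord. Qed.

Lemma win_subproof (J n : nat) (i : 'I_J) (k : 'I_n.+1) : (i + k < J + n)%N.
Proof. by have := ltn_ord i; have := ltn_ord k; lia. Qed.

(** Sizes count sites per direction: a window of [n.+1] sites has exactly [J] positions among
    [J + n] sites. *)
Definition win (d J n : nat) (x : cube d J) (y : cube d n.+1) : cube d (J + n) :=
  [ffun i => Ordinal (win_subproof (x i) (y i))].

Lemma win_inj (d J n : nat) (x : cube d J) : injective (@win d J n x).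
Proof.
move=> y z /ffunP yz; apply/ffunP => i; apply/val_inj.
by have := congr1 val (yz i); rewrite !ffunE /= => /addnI.
Qed.

Section Occurrences.
Variables (R : realFieldType) (d n : nat).
Implicit Types E : pred {ffun cube d n.+1 -> bool}.

Definition occurs E (J : nat) : pred {ffun cube d (J + n) -> bool} :=
  fun s => [exists x : cube d J, E (pull (win x) s)].

Lemma pr_win E J (x : cube d J) : pr R (fun s => E (pull (win x) s)) = pr R E.
Proof. exact: (pr_pull R E (@win_inj d J n x)). Qed.

Lemma pr_occurs_le E J : pr R (@occurs E J) <= (J ^ d)%:R * pr R E.
Proof.
apply: le_trans (@pr_exists_in R _ _ xpredT (fun x s => E (pull (win x) s))) _.
by under eq_bigr do rewrite pr_win; rewrite sumr_const card_cube mulr_natl.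
Qed.

(** The positions differ in some direction [i]. The segment needed by [pr_overlap] runs along
    another direction [i'], in the face of the window at [y] that lies beyond the window at [x] in
    direction [i]. *)
Lemma pr_win_neq (A : {ffun cube d n.+1 -> bool}) (r J : nat) (x y : cube d J) :
  (2 <= d)%N -> (growth_ratio.+1 * r <= n.+1 ^ d)%N -> x != y ->
  pr R (fun s => (dist (pull (win x) s) A <= r)%N &&
                 (dist (pull (win y) s) A <= r)%N) <=
  2 * (6 / 7) ^+ n.+1 * pr R (fun a => (dist a A <= r)%N).
Proof.
move=> d2 rd xy.
have [i xyi] : exists i, x i != y i.
  apply/existsP; rewrite -negb_forall; apply: contra xy => /forallP e.
  by apply/eqP/ffunP => i; apply/eqP.
have [i' ii'] : exists i', i != i'.
  have [i0|i0] := eqVneq (val i) 0%N.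
    (* Read as [1 < d], [d2] provides the index 1; [ltnW d2] provides the index 0. *)
    by exists (Ordinal d2); rewrite -val_eqE /= i0.
  by exists (Ordinal (ltnW d2)); rewrite -val_eqE /=.
pose v : 'I_n.+1 := if (x i < y i)%N then ord_max else ord0.
pose f (c : 'I_n.+1) : cube d n.+1 := [ffun k => if k == i' then c else v].
have fI : injective f.
  by move=> c c' /ffunP/(_ i'); rewrite !ffunE eqxx.
rewrite -[X in _ ^+ X](card_ord n.+1).
apply: (pr_overlap R A fI (@win_inj d J n x) (@win_inj d J n y)); last by rewrite card_cube.
move=> z c; apply/eqP => /ffunP/(_ i) /(congr1 val); rewrite !ffunE /= (negPf ii') /v.
move: xyi; rewrite -val_eqE /=; have := ltn_ord (z i).
by case: (ltnP (x i) (y i)) => /=; lia.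
Qed.

Definition close J (x y : cube d J) :=
  [forall i, (y i <= x i + n)%N && (x i <= y i + n)%N].

Lemma card_close J (x : cube d J) : (#|[set y | close x y]| <= (n + n).+1 ^ d)%N.
Proof.
pose f (y : cube d J) : cube d (n + n).+1 := [ffun i => inord (y i + n - x i)].
rewrite -(card_cube d (n + n).+1) -(card_in_imset (f := f)) ?max_card //.
move=> y z; rewrite !inE => /forallP yP /forallP zP /ffunP yz.
apply/ffunP => i; apply/val_inj; move: (yP i) (zP i) => /andP[? ?] /andP[? ?].
have := congr1 val (yz i); rewrite !ffunE /= !inordK; lia.
Qed.

Lemma pr_win_far E J (x y : cube d J) : ~~ close x y ->
  pr R (fun s => E (pull (win x) s) && E (pull (win y) s)) = pr R E ^+ 2.
Proof.
rewrite negb_forall => /existsP[i xyi]; rewrite expr2.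
apply: pr_indep2; [exact: win_inj|exact: win_inj|move=> z w].
apply/eqP => /ffunP/(_ i) /(congr1 val); rewrite !ffunE /=.
have := ltn_ord (z i); have := ltn_ord (w i); move: xyi.
by move: (val (x i)) (val (y i)) (val (z i)) (val (w i)) => /= a b c e; lia.
Qed.

(** Second moment method. For a fixed [x], the term [y = x] contributes at most [pr R E], the close
    positions are counted by [card_close] and weighted by [pr_win_neq], and the far ones contribute
    at most [(J ^ d)%:R * pr R E ^+ 2], hence at most [pr R E] by the hypothesis. *)
Lemma pr_occurs_ge (A : {ffun cube d n.+1 -> bool}) (r J : nat) :
  (2 <= d)%N -> (growth_ratio.+1 * r <= n.+1 ^ d)%N ->
  let E := fun a => (dist a A <= r)%N in
  (J ^ d)%:R * pr R E <= 1 ->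
  (J ^ d)%:R * pr R E <=
    (2 + 2 * ((n + n).+1 ^ d)%:R * (6 / 7) ^+ n.+1) * pr R (@occurs E J).
Proof.
move=> d2 rd E JE; set eta : R := (6 / 7) ^+ n.+1; set M := 2 + _.
have E0 := pr_ge0 R E.
have eta0 : 0 <= eta by rewrite exprn_ge0 // divr_ge0.
have etaE0 : 0 <= 2 * eta * pr R E by exact: (mulr_ge0 (mulr_ge0 (ler0n _ 2) eta0) E0).
have M0 : 0 < M by apply: ltr_wpDr => //; apply: mulr_ge0 => //; apply: mulr_ge0.
have := @second_moment R _ _ (fun (x : cube d J) s => E (pull (win x) s)) M M0.
under eq_bigr do rewrite pr_win.
rewrite sumr_const card_cube mulr_natl; apply => x; rewrite pr_win.
apply: (@le_trans _ _ (\sum_(y : cube d J) ((y == x)%:R * pr R E +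
  (close x y)%:R * (2 * eta * pr R E) + pr R E ^+ 2))).
  apply: ler_sum => y _.
  have [->|yx] := eqVneq y x.
    rewrite -addrA mul1r; apply: ler_wpDr; last first.
      by rewrite -(pr_win E x); apply: pr_le => s /andP[].
    exact: addr_ge0 (mulr_ge0 (ler0n _ _) etaE0) (exprn_ge0 2 E0).
  rewrite mul0r add0r; have [cl|far] := boolP (close x y).
    rewrite mul1r; apply: ler_wpDr; first exact: exprn_ge0.
    by apply: (pr_win_neq A d2 rd); rewrite eq_sym.
  by rewrite mul0r add0r pr_win_far.
rewrite !big_split /= sumr_const card_cube -[_ *+ (J ^ d)]mulr_natl expr2 mulrA -!mulr_suml.
have -> : \sum_(y : cube d J) (y == x)%:R = 1 :> R.
  by rewrite (bigD1 x) //= eqxx big1 ?addr0 // => y /negPf->.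
have -> : \sum_(y : cube d J) (close x y)%:R = #|[set y | close x y]|%:R :> R.
  by rewrite -sum1dep_card natr_sum [RHS]big_mkcond; apply: eq_bigr => y _; case: close.
rewrite /M.
have h1 : (J ^ d)%:R * pr R E * pr R E <= pr R E by apply: ler_piMl.
have h2 : #|[set y | close x y]|%:R * (2 * eta * pr R E) <=
    ((n + n).+1 ^ d)%:R * (2 * eta * pr R E).
  by apply: ler_wpM2r => //; rewrite ler_nat card_close.
have -> : (2 + 2 * ((n + n).+1 ^ d)%:R * eta) * pr R E = pr R E +
  ((n + n).+1 ^ d)%:R * (2 * eta * pr R E) + pr R E by ring.
by rewrite mul1r; apply: lerD => //; apply: lerD.
Qed.

(** * Tiling a cube by independent blocks *)

Section Blocks.
Variables (L b J : nat).
Hypothesis bJ : (b * (L + n) <= J + n)%N.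

Lemma block_subproof (u : 'I_b) (z : 'I_(L + n)) : (u * (L + n) + z < J + n)%N.
Proof.
apply: leq_trans bJ; apply: (@leq_trans (u.+1 * (L + n))); last by rewrite leq_mul2r ltn_ord orbT.
by rewrite mulSn addnC ltn_add2r.
Qed.

Lemma block_pos_subproof (u : 'I_b) (v : 'I_L) : (u * (L + n) + v < J)%N.
Proof.
have h : (v + n < L + n)%N by rewrite ltn_add2r.
by have := block_subproof u (Ordinal h); rewrite /= addnA ltn_add2r.
Qed.

Definition block (u : cube d b) (z : cube d (L + n)) : cube d (J + n) :=
  [ffun i => Ordinal (block_subproof (u i) (z i))].

(** Only the first [L] offsets per direction keep a window inside its tile; windows at the last [n]
    offsets leave it, and their positions belong to the tiling defect. *)
Definition block_pos (w : cube d b * cube d L) : cube d J :=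
  [ffun i => Ordinal (block_pos_subproof (w.1 i) (w.2 i))].

Lemma win_block_pos u v y : win (block_pos (u, v)) y = block u (win v y).
Proof. by apply/ffunP => i; apply/val_inj; rewrite !ffunE /= addnA. Qed.

Lemma block_inj : injective (fun w : cube d b * cube d (L + n) => block w.1 w.2).
Proof.
move=> [u z] [u' z'] /= /ffunP e.
have uz i : u i = u' i /\ z i = z' i.
  have /(congr1 val) := e i; rewrite !ffunE /= => ei.
  have L0 : (0 < L + n)%N by apply: leq_ltn_trans (ltn_ord (z i)).
  split; apply/val_inj.
    have := congr1 (divn^~ (L + n)%N) ei.
    by rewrite !divnMDl // !divn_small ?ltn_ord // !addn0.
  by have := congr1 (modn^~ (L + n)%N) ei; rewrite !modnMDl !modn_small ?ltn_ord.
by congr (_, _); apply/ffunP => i; have [] := uz i.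
Qed.

Lemma block_pos_inj : injective block_pos.
Proof.
move=> [u v] [u' v'] /ffunP e.
have uv i : u i = u' i /\ v i = v' i.
  have /(congr1 val) := e i; rewrite !ffunE /= => ei.
  have := ltn_ord (v i); have := ltn_ord (v' i) => v'L vL.
  have vn : (v i < L + n)%N by lia.
  have vn' : (v' i < L + n)%N by lia.
  have L0 : (0 < L + n)%N by lia.
  split; apply/val_inj.
    have := congr1 (divn^~ (L + n)%N) ei.
    by rewrite !divnMDl // !divn_small ?addn0.
  by have := congr1 (modn^~ (L + n)%N) ei; rewrite !modnMDl !modn_small.
by congr (_, _); apply/ffunP => i; have [] := uv i.
Qed.

Lemma pull_block E u v s :
  E (pull (win v) (pull (block u) s)) = E (pull (win (block_pos (u, v))) s).
Proof. by congr E; apply/ffunP => y; rewrite !ffunE win_block_pos. Qed.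

Lemma pr_no_block E :
  pr R (fun s => [forall u : cube d b, ~~ @occurs E L (pull (block u) s)]) =
    (1 - pr R (@occurs E L)) ^+ (b ^ d).
Proof.
rewrite (@pr_indep R _ _ _ block (fun a => ~~ @occurs E L a) block_inj).
by rewrite pr_not card_cube.
Qed.

Lemma pr_no_occurs_le E :
  1 - pr R (@occurs E J) <= (1 - pr R (@occurs E L)) ^+ (b ^ d).
Proof.
rewrite -pr_no_block -pr_not; apply: pr_le => s /existsPn noE.
by apply/forallP => u; apply/existsPn => v; rewrite pull_block.
Qed.

(** If no block contains an occurrence, then an occurrence in the large cube starts at a position
    outside the range of [block_pos]; a union bound over these positions gives the error term. *)
Lemma pr_no_occurs_ge E :
  (1 - pr R (@occurs E L)) ^+ (b ^ d) <=
    1 - pr R (@occurs E J) + (J ^ d - (b * L) ^ d)%:R * pr R E.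
Proof.
pose out (x : cube d J) := x \notin codom block_pos.
have cout : #|out| = (J ^ d - (b * L) ^ d)%N.
  rewrite expnMn -!card_cube -card_prod -(card_codom block_pos_inj).
  by rewrite -(cardC (mem (codom block_pos))) addKn; apply: eq_card.
rewrite -pr_no_block -pr_not.
apply: (@le_trans _ _ (pr R (fun s => ~~ @occurs E J s ||
    [exists x, out x && E (pull (win x) s)]))).
  apply: pr_le => s /forallP noE; rewrite -implybE; apply/implyP => /existsP[x Ex].
  apply/existsP; exists x; rewrite Ex andbT; apply/negP => /codomP[[u v] xE].
  by have /existsPn/(_ v) := noE u; rewrite pull_block -xE Ex.
apply: le_trans (pr_or R _ _) _; rewrite lerD2l.
apply: le_trans (@pr_exists_in R _ (cube d J) out (fun x s => E (pull (win x) s))) _.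
by under eq_bigr do rewrite pr_win; rewrite sumr_const cout mulr_natl.
Qed.

End Blocks.
End Occurrences.

(** * Counting the positions missed by a tiling *)

Lemma expnD_le (d y k : nat) :
  ((y + k) ^ d.+1 <= y ^ d.+1 + d.+1 * (y + k) ^ d * k)%N.
Proof.
elim: d => [|d IH]; first by rewrite expn0 !expn1 !mul1n.
rewrite expnS [in leqRHS]expnS.
have h : (y * (y + k) ^ d <= (y + k) ^ d.+1)%N by rewrite expnS leq_mul2r leq_addr orbT.
move: IH h; move: (y ^ d.+1)%N ((y + k) ^ d.+1)%N ((y + k) ^ d)%N => a e f IH h.
have := leq_mul (leqnn y) IH; have := leq_mul h (leqnn (d.+1 * k)); nia.
Qed.

(* The lattice points of a box of side [j] that are not among the first [L ^ d]
   positions of a tile, when the box is tiled with side [L + n]. *)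
Lemma tiling_defect (d n L j : nat) : (0 < d)%N -> (0 < L)%N ->
  ((j.+1 ^ d - (j %/ (L + n) * L) ^ d) * L <=
    d * n.+1 * (L ^ (2 * d) + 2 * j.+1 ^ d))%N.
Proof.
case: d => // d _ L0; set b := (j %/ (L + n))%N.
have jE := divn_eq j (L + n); have Ln : (0 < L + n)%N by lia.
have jmod := ltn_pmod j Ln; rewrite -/b in jE.
have bj : (b * L <= j)%N by rewrite jE mulnDr; lia.
set x := j.+1; set k := (x - b * L)%N.
have xE : x = (b * L + k)%N by rewrite /k subnKC // /x; lia.
(* The gap [k] consists of [n] sites for each of the [b] tiles and of a last part of at most [L + n]
   sites. *)
have kL : (k * L <= x * n + L * (L + n))%N.
  have : (k <= b * n + (L + n))%N by rewrite /k /x; move: jE; rewrite mulnDr; lia.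
  have : (b * L * n <= x * n)%N by rewrite leq_mul2r /x; lia.
  by nia.
have h1 : (x ^ d.+1 - (b * L) ^ d.+1 <= d.+1 * x ^ d * k)%N.
  by rewrite leq_subLR; have := expnD_le d (b * L) k; rewrite -xE.
have h2 : (x ^ d * (L * (L + n)) <= n.+1 * (L ^ (2 * d.+1) + x ^ d.+1))%N.
  have LL : (L * (L + n) <= L ^ 2 * n.+1)%N by rewrite expnS expn1 -mulnA leq_mul2l; nia.
  apply: leq_trans (leq_mul (leqnn _) LL) _; rewrite mulnA [leqRHS]mulnC leq_mul2r.
  (* For [x <= L ^ 2] the first summand on the right suffices, otherwise the second one does. *)
  apply/orP; right; have [xL|xL] := leqP x (L ^ 2).
    apply: leq_trans (leq_addr _ _).
    rewrite expnM [leqRHS]expnSr leq_mul2r; apply/orP; right.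
    by case: (d) => // e; rewrite leq_exp2r.
  by apply: leq_trans (leq_addl _ _); rewrite [leqRHS]expnSr leq_mul2l (ltnW xL) orbT.
apply: leq_trans (leq_mul h1 (leqnn L)) _.
have h3 : (x ^ d * (k * L) <= n.+1 * (L ^ (2 * d.+1) + 2 * x ^ d.+1))%N.
  apply: leq_trans (leq_mul (leqnn (x ^ d)) kL) _; rewrite mulnDr.
  have -> : (x ^ d * (x * n) = n * x ^ d.+1)%N by rewrite mulnA -expnSr mulnC.
  by move: h2; set X := (x ^ d.+1)%N; nia.
by rewrite -!mulnA leq_mul2l h3 orbT.
Qed.

Lemma tiling_count_le (n L j : nat) : (j %/ (L + n) * L <= j - n)%N.
Proof.
have := leq_divM j (L + n); case: (j %/ (L + n))%N => // b.
by rewrite mulnDr mulSn (mulSn b n); lia.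
Qed.

Lemma ltn_divM4 (m j : nat) : (0 < m)%N -> (m <= j)%N -> (j < 4 * (j %/ m) * m)%N.
Proof.
move=> m0 mj; have b0 : (0 < j %/ m)%N by rewrite divn_gt0.
have := ltn_ceil j m0; nia.
Qed.

(** * Estimates for exponentials and logarithms *)

Section Analysis.
Variable R : realType.

Lemma expRN_lip (u v : R) : 0 <= u -> u <= v -> expR (- u) - expR (- v) <= v - u.
Proof.
move=> u0 uv; have -> : - v = - u + (u - v) by ring.
rewrite expRD -[X in X - _]mulr1 -mulrBr.
have e1 : expR (- u) <= 1 by rewrite -expR0 ler_expR; lra.
have e2 := expR_ge1Dx (u - v); have e0 := expR_ge0 (- u).
have h : 0 <= v - u by lra.
apply: le_trans (_ : expR (- u) * (v - u) <= _).
  by apply: ler_wpM2l => //; lra.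
by apply: ler_piMl.
Qed.

(** The lower bound is [1 - p <= expR (- p)]. The upper one is [ln (1 + u) <= u] at
    [u = p / (1 - p)], where [(1 - p)^-1 <= 7]. *)
Lemma ln_onem_bounds (p : R) : 0 <= p <= 6 / 7 -> p <= - ln (1 - p) <= 7 * p.
Proof.
move=> /andP[p0 p1]; have q0 : 0 < 1 - p by lra.
have e := @expR_ge1Dx R; apply/andP; split.
  by rewrite lerNr -ler_expR lnK ?posrE // e.
rewrite -lnV ?posrE //; have -> : (1 - p)^-1 = 1 + ((1 - p)^-1 - 1) by ring.
have q7 : (1 - p)^-1 <= 7 by rewrite invf_ple ?posrE //; lra.
have qE : (1 - p)^-1 - 1 = p * (1 - p)^-1 by field; lra.
apply: (le_trans (le_ln1Dx _)); first by rewrite ltrBrDl subrr invr_gt0.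
by rewrite qE mulrC ler_wpM2r.
Qed.

Lemma natr_le_expR (a : R) (k : nat) : 0 < a -> k%:R <= a^-1 * expR (a * k%:R).
Proof.
move=> a0; rewrite ler_pdivlMl //; apply: le_trans (expR_ge1Dx _); lra.
Qed.

(** Multiply the two hypotheses and take a square root. Half of the decay [expR (- (c * t))] absorbs
    the factor [1 + t], and the root of the other half leaves the rate [c / 4]. The constant [1 + W]
    dominates the square root of [W], since [W <= (1 + W) ^+ 2]. *)
Lemma exp_approx (x t a Z c k : R) : 0 <= t -> 0 < c -> 0 <= Z -> 0 <= a ->
  `|x| <= Z * (1 + t) * expR (- (2 * k)) -> `|x| <= a * expR (- (c * t)) ->
  `|x| <= (1 + Z * a * (1 + 2 / c)) * expR (- (c / 4 * t)) * expR (- k).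
Proof.
move=> t0 c0 Z0 a0 h1 h2; set W := Z * a * (1 + 2 / c).
have W0 : 0 <= W by rewrite !mulr_ge0 // addr_ge0 // divr_ge0 // ltW.
set y := expR (- (c / 4 * t)) * expR (- k).
have y0 : 0 <= y by rewrite mulr_ge0 ?expR_ge0.
rewrite -mulrA -ler_sqr ?nnegrE ?normr_ge0 ?mulr_ge0 ?addr_ge0 //.
apply: (@le_trans _ _ (W * y ^+ 2)); last first.
  rewrite [leRHS]exprMn ler_wpM2r ?exprn_ge0 //.
  by rewrite sqrrD mul1r expr1n; have := sqr_ge0 W; lra.
rewrite expr2; apply: le_trans (ler_pM (normr_ge0 _) (normr_ge0 _) h1 h2) _.
have yE : y ^+ 2 = expR (- (c / 2 * t)) * expR (- (2 * k)).
  by rewrite exprMn -!expRM_natl; congr (expR _ * expR _); field.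
have ct : 1 + t <= (1 + 2 / c) * expR (c / 2 * t).
  have e := expR_ge1Dx (c / 2 * t); have c1 : 0 <= 2 / c by rewrite divr_ge0 // ltW.
  apply: (@le_trans _ _ ((1 + 2 / c) * (1 + c / 2 * t))); last first.
    by rewrite ler_wpM2l // addr_ge0.
  have -> : (1 + 2 / c) * (1 + c / 2 * t) = 1 + t + (2 / c + c / 2 * t) by field; lra.
  by rewrite lerDl addr_ge0 // !mulr_ge0 // ltW.
have eE : expR (- (c * t)) * expR (c / 2 * t) = expR (- (c / 2 * t)).
  by rewrite -expRD; congr expR; field.
have -> : Z * (1 + t) * expR (- (2 * k)) * (a * expR (- (c * t))) =
  (Z * a * expR (- (2 * k)) * expR (- (c * t))) * (1 + t) by ring.
have -> : W * y ^+ 2 = (Z * a * expR (- (2 * k)) * expR (- (c * t))) *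
   ((1 + 2 / c) * expR (c / 2 * t)).
  by rewrite yE -eE /W; ring.
by rewrite ler_wpM2l // !mulr_ge0 ?expR_ge0.
Qed.

End Analysis.

(** * The side of the tiles *)

Section Scale.
Variables (R : realType) (d n : nat).
Hypothesis d2 : (2 <= d)%N.

(* [20 * d] makes [side ^ (2 * d)] at most [(7 / 6) ^ N] for [N = n.+1 ^ d]. *)
Definition side : nat := 2 ^ ((n.+1 ^ d) %/ (20 * d)).

Let m := ((n.+1 ^ d) %/ (20 * d))%N.

Lemma side_gt0 : (0 < side)%N. Proof. by rewrite expn_gt0. Qed.

Lemma side_expn2_le : (6 / 7) ^+ (n.+1 ^ d) * (side ^ (2 * d))%:R <= 1 :> R.
Proof.
have mN : (10 * (m * (2 * d)) <= n.+1 ^ d)%N.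
  by have := leq_divM (n.+1 ^ d) (20 * d); rewrite -/m; lia.
apply: (@le_trans _ _ ((6 / 7) ^+ (10 * (m * (2 * d))) * (side ^ (2 * d))%:R)).
  by rewrite ler_wpM2r // ler_wiXn2l //; lra.
rewrite /side -expnM natrX exprM -exprMn; apply: exprn_ile1; first by lra.
lra.
Qed.

(** The strict inequality [5 * (m * d) < n.+1 ^ d] saves one factor [6 / 7]. It keeps the
    probability of an occurrence away from 1, so that the logarithm in [rate] is under control. *)
Lemma side_expn_le : (6 / 7) ^+ (n.+1 ^ d) * (side ^ d)%:R <= 6 / 7 :> R.
Proof.
have N0 : (0 < n.+1 ^ d)%N by rewrite expn_gt0.
have mN : ((5 * (m * d)).+1 <= n.+1 ^ d)%N.
  by have := leq_divM (n.+1 ^ d) (20 * d); rewrite -/m; lia.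
apply: (@le_trans _ _ ((6 / 7) ^+ (5 * (m * d)).+1 * (side ^ d)%:R)).
  by rewrite ler_wpM2r // ler_wiXn2l //; lra.
rewrite /side -expnM natrX exprS exprM -mulrA -exprMn.
apply: ler_piMr; first by lra.
apply: exprn_ile1; first by lra.
lra.
Qed.

(** As [expR 2^-1 <= 2], twice the side is at least [expR (N / (40 * d))]; the factor 2 makes up for
    rounding down the exponent. Half of this growth absorbs [n.+1 <= N], the other half is the
    exponential gain. *)
Lemma side_ge :
  n.+1%:R <= 160 * d%:R * expR (- (2 * ((160 * d%:R)^-1 * (n ^ d)%:R))) * side%:R :> R.
Proof.
set N := (n.+1 ^ d)%N.
have d0 : 0 < d%:R :> R by rewrite ltr0n; lia.
have sE : expR ((40 * d%:R)^-1 * N%:R) <= 2 * side%:R :> R.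
  have hm : (N <= m.+1 * (20 * d))%N by apply/ltnW/ltn_ceil; lia.
  apply: (@le_trans _ _ (expR (2^-1 * m.+1%:R))).
    rewrite ler_expR ler_pdivrMl ?mulr_gt0 //.
    move: hm; rewrite -(ler_nat R) !natrM => /le_trans; apply.
    by rewrite le_eqVlt; apply/orP; left; apply/eqP; field.
  have -> : 2 * side%:R = 2 ^+ m.+1 :> R by rewrite /side natrX exprS.
  rewrite expRM_natr lerXn2r ?nnegrE ?expR_ge0 //.
  rewrite -[X in expR X]opprK expRN invf_ple ?posrE ?expR_gt0 //.
  by apply: le_trans (expR_ge1Dx _); lra.
have nN : n.+1%:R <= N%:R :> R.
  by rewrite ler_nat /N -{1}(expn1 n.+1) leq_pexp2l //; lia.
apply: le_trans nN _.
have a0 : 0 < (80 * d%:R)^-1 :> R by rewrite invr_gt0 mulr_gt0.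
apply: (le_trans (natr_le_expR N a0)); rewrite invrK.
have -> : expR ((80 * d%:R)^-1 * N%:R) =
    expR (- ((80 * d%:R)^-1 * N%:R)) * expR ((40 * d%:R)^-1 * N%:R) :> R.
  by rewrite -expRD; congr expR; field; rewrite gt_eqF.
have -> : (160 * d%:R : R) = 80 * d%:R * 2 by ring.
rewrite -!mulrA ler_pM2l // ler_pM2l // mulrCA ler_pM ?expR_ge0 //.
rewrite ler_expR lerN2.
have -> : 2 * ((80 * (d%:R * 2))^-1 * (n ^ d)%:R) = (80 * d%:R)^-1 * (n ^ d)%:R :> R.
  by field; rewrite gt_eqF.
by rewrite ler_pM2l // ler_nat leq_exp2r //; lia.
Qed.

End Scale.

(** Here [6 / 7 <= expR (- 7^-1)], and the exponent [(7 * d)^-1] is chosen so that the power [d] of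
    its exponential cancels this decay exactly. *)
Lemma polynomial_decay (R : realType) (d n : nat) : (0 < d)%N ->
  ((n + n).+1 ^ d)%:R * (6 / 7) ^+ n.+1 <= (14 * d%:R) ^+ d :> R.
Proof.
move=> dp; have d0 : 0 < d%:R :> R by rewrite ltr0n.
have a0 : 0 < (7 * d%:R)^-1 :> R by rewrite invr_gt0 mulr_gt0.
have e7 : (6 / 7) ^+ n.+1 <= expR (- (7^-1 * n.+1%:R)) :> R.
  rewrite -mulNr expRM_natr lerXn2r ?nnegrE ?expR_ge0 ?divr_ge0 //.
  by apply: le_trans (expR_ge1Dx _); lra.
have h : (n + n).+1%:R <= 14 * d%:R * expR ((7 * d%:R)^-1 * n.+1%:R) :> R.
  apply: (@le_trans _ _ (2 * n.+1%:R)); first by rewrite -natrM ler_nat; lia.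
  rewrite (_ : 14 * _ * _ = 2 * (7 * d%:R * expR ((7 * d%:R)^-1 * n.+1%:R))); last by ring.
  by rewrite ler_pM2l //; have := natr_le_expR n.+1 a0; rewrite invrK.
apply: (@le_trans _ _ ((14 * d%:R * expR ((7 * d%:R)^-1 * n.+1%:R)) ^+ d *
    expR (- (7^-1 * n.+1%:R)))).
  by rewrite ler_pM ?exprn_ge0 ?divr_ge0 // natrX lerXn2r ?nnegrE ?mulr_ge0 ?expR_ge0 // ltW.
rewrite exprMn -expRM_natl -mulrA -expRD.
rewrite (_ : _ + _ = 0) ?expR0 ?mulr1 //; field; by rewrite gt_eqF.
Qed.

(** The constant of [pr_occurs_ge], made uniform in [n] by [polynomial_decay]. *)
Definition overlap_bound (R : realType) (d : nat) : R := 2 + 2 * (14 * d%:R) ^+ d.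

Lemma overlap_bound_gt0 (R : realType) (d : nat) : 0 < overlap_bound R d.
Proof. by rewrite ltr_pwDl // mulr_ge0 // exprn_ge0 // mulr_ge0. Qed.

(** * The rate and the exponential law in finite cubes *)

Section Rate.
Variables (R : realType) (d n r : nat) (A : {ffun cube d n.+1 -> bool}).
Hypothesis d2 : (2 <= d)%N.
Hypothesis rd : (growth_ratio.+1 * r <= n.+1 ^ d)%N.

Let E : pred {ffun cube d n.+1 -> bool} := fun a => (dist a A <= r)%N.
Let L : nat := side d n.
Let p : R := pr R (@occurs d n E L).
Let M : R := overlap_bound R d.

Definition rate : R := - ln (1 - p) / (pr R E * (L ^ d)%:R).

Let L0 : (0 < L)%N := side_gt0 d n.
Let d0 : (0 < d)%N := ltnW d2.

Lemma pr_ball_gt0 : 0 < pr R E.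
Proof.
rewrite /pr divr_gt0 ?exprn_gt0 // ltr0n card_gt0; apply/set0Pn; exists A.
by rewrite inE /E /dist (_ : [set x | _] = finset.set0) ?cards0 //;
  apply/setP => x; rewrite !inE eqxx.
Qed.

Lemma pr_ball_le : pr R E <= (6 / 7) ^+ (n.+1 ^ d).
Proof.
rewrite /E pr_dist card_cube; apply: ball_card_chernoff.
by apply: leq_trans rd; rewrite leq_mul2r; apply/orP; right.
Qed.

Lemma pr_ball_side2 : pr R E * (L ^ (2 * d))%:R <= 1.
Proof. by apply: le_trans (side_expn2_le R n d2); rewrite ler_wpM2r // pr_ball_le. Qed.

Lemma pr_ball_side : pr R E * (L ^ d)%:R <= 6 / 7.
Proof. by apply: le_trans (side_expn_le R n d2); rewrite ler_wpM2r // pr_ball_le. Qed.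

Lemma pr_occurs_side_le : p <= pr R E * (L ^ d)%:R.
Proof. by rewrite mulrC; apply: pr_occurs_le. Qed.

Lemma pr_occurs_side_bounds : 0 <= p <= 6 / 7.
Proof. by rewrite pr_ge0 /=; apply: le_trans pr_occurs_side_le pr_ball_side. Qed.

Lemma pr_occurs_side_ge : pr R E * (L ^ d)%:R <= M * p.
Proof.
have h : pr R E * (L ^ d)%:R <= 1 by apply: le_trans pr_ball_side _; lra.
rewrite mulrC; rewrite mulrC in h.
apply: (le_trans (pr_occurs_ge d2 rd h)); rewrite ler_wpM2r ?pr_ge0 //.
by rewrite lerD2l -mulrA ler_wpM2l // polynomial_decay.
Qed.

Let M_gt0 : 0 < M := overlap_bound_gt0 R d.

(** The lower bound comes from the second moment method, the upper one from the union bound for [p];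
    neither constant depends on [n] or [A]. *)
Lemma rate_bounds : M^-1 <= rate <= 7.
Proof.
have PL : 0 < pr R E * (L ^ d)%:R by rewrite mulr_gt0 ?pr_ball_gt0 // ltr0n expn_gt0 L0.
have /andP[h1 h2] := ln_onem_bounds pr_occurs_side_bounds.
rewrite /rate ler_pdivlMr // ler_pdivrMr //; apply/andP; split.
  by apply: le_trans h1; rewrite ler_pdivrMl ?M_gt0 // pr_occurs_side_ge.
by apply: le_trans h2 _; rewrite ler_pM2l // pr_occurs_side_le.
Qed.

Lemma rate_gt0 : 0 < rate.
Proof. by have /andP[+ _] := rate_bounds; apply: lt_le_trans; rewrite invr_gt0 M_gt0. Qed.

Let rateE_ge0 : 0 <= rate * pr R E.
Proof. exact: mulr_ge0 (ltW rate_gt0) (ltW pr_ball_gt0). Qed.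

(** With this choice of [rate], the law over the tiles is exactly exponential in the number of
    positions they hold. *)
Lemma no_block_expR b :
  (1 - p) ^+ (b ^ d) = expR (- (rate * pr R E * ((b * L) ^ d)%:R)).
Proof.
have /andP[p0 p1] := pr_occurs_side_bounds.
rewrite -[1 - p]lnK ?posrE; last by lra.
rewrite -expRM_natl; congr expR; rewrite /rate expnMn natrM natrX natrX.
by field; rewrite expf_neq0 ?pnatr_eq0 -?lt0n //= gt_eqF ?pr_ball_gt0.
Qed.

Section Approximation.
Variables (j : nat) (s : R).
Hypothesis js : (j ^ d)%:R <= s < (j.+1 ^ d)%:R.

Let b : nat := (j %/ (L + n))%N.
(** A cube with [j] sites per direction has [j - n] positions. For [j <= n] the truncated difference
    is 0, no window fits, and [q = 1]. *)
Let q : R := 1 - pr R (@occurs d n E (j - n)).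
Let t : R := rate * pr R E * s.

Let s0 : 0 <= s.
Proof. by have /andP[+ _] := js; apply: le_trans. Qed.

Let t0 : 0 <= t.
Proof. exact: mulr_ge0 rateE_ge0 s0. Qed.

Let bj : (b * (L + n) <= j)%N.
Proof. exact: leq_divM. Qed.

Let bJ : (b * (L + n) <= j - n + n)%N.
Proof. by apply: leq_trans bj _; rewrite addnC -leq_subLR. Qed.

Let q_le : q <= expR (- (rate * pr R E * ((b * L) ^ d)%:R)).
Proof. by rewrite -no_block_expR; apply: pr_no_occurs_le bJ _. Qed.

Lemma no_occurs_approx :
  `|q - expR (- t)| <= 8 * d%:R * (3 + 2 ^+ d.+1 * M * t) * (n.+1%:R / L%:R).
Proof.
have /andP[js1 js2] := js; have P0 := pr_ball_gt0; have r0 := rate_gt0.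
have /andP[rM r7] := rate_bounds.
set y : R := ((b * L) ^ d)%:R; set x : R := (j.+1 ^ d)%:R.
have yj : y <= (j ^ d)%:R.
  by rewrite ler_nat leq_exp2r //; apply: leq_trans bj; rewrite mulnDr leq_addr.
have q1 : expR (- (rate * pr R E * y)) - (x - y) * pr R E <= q.
  rewrite -no_block_expR lerBlDr; apply: le_trans (pr_no_occurs_ge R bJ E) _.
  rewrite lerD2l ler_wpM2r ?(ltW P0) // natrB.
    by rewrite lerD2r ler_nat leq_exp2r // (leq_trans (leq_subr _ _)).
  by rewrite leq_exp2r // tiling_count_le.
have W1 : expR (- (rate * pr R E * y)) - expR (- t) <= 7 * ((x - y) * pr R E).
  apply: le_trans (expRN_lip _ _) _.
  - by rewrite mulr_ge0.
  - by rewrite ler_wpM2l //; apply: le_trans yj js1.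
  rewrite /t -mulrBr -mulrA (mulrC (pr R E)); apply: ler_pM => //; first exact: ltW.
    by rewrite mulr_ge0 ?(ltW P0) // subr_ge0; apply: le_trans yj js1.
  by rewrite ler_pM2r // lerD2r ltW.
have W2 : expR (- t) <= expR (- (rate * pr R E * y)).
  rewrite ler_expR lerN2 ler_wpM2l //.
  by apply: le_trans yj js1.
have D0 : 0 <= (x - y) * pr R E.
  rewrite mulr_ge0 ?(ltW P0) // subr_ge0; apply: le_trans yj _.
  exact: le_trans js1 (ltW js2).
(* Both [q] and [expR (- t)] are compared with the law over the tiles: the union bound costs one
   defect, the exponential at most seven because [rate <= 7]. *)
apply: (@le_trans _ _ (8 * ((x - y) * pr R E))).
  by rewrite ler_norml; apply/andP; split; move: q_le q1 W1 W2 D0; rewrite -/y; lra.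
have xs : x <= 1 + 2 ^+ d * s.
  rewrite /x; case: (posnP j) => [->|j0].
    by rewrite exp1n lerDl mulr_ge0 // exprn_ge0.
  apply: (@le_trans _ _ (2 ^+ d * s)); last by rewrite lerDr.
  apply: le_trans (_ : _ <= 2 ^+ d * (j ^ d)%:R) _; last by rewrite ler_wpM2l ?exprn_ge0.
  by rewrite -natrX -natrM -expnMn ler_nat leq_exp2r // mul2n -addnn -addn1 leq_add2l.
have sP : s * pr R E <= M * t.
  have -> : M * t = M * rate * (s * pr R E) by rewrite /t; ring.
  apply: ler_peMl; first exact: mulr_ge0 s0 (ltW P0).
  by rewrite -ler_pdivrMl ?M_gt0 // mulr1.
have P1 : pr R E <= 1 := pr_le1 R E.
have xP : x * pr R E <= 1 + 2 ^+ d * (M * t).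
  apply: (@le_trans _ _ ((1 + 2 ^+ d * s) * pr R E)); first by rewrite ler_pM2r.
  by rewrite mulrDl mul1r -mulrA lerD // ler_wpM2l ?exprn_ge0.
have Lr : 0 < L%:R :> R by rewrite ltr0n.
have yx : ((b * L) ^ d <= j.+1 ^ d)%N.
  by rewrite -(ler_nat R) -subr_ge0 -(pmulr_lge0 _ P0).
have := tiling_defect n j d0 L0; rewrite -/b -(ler_nat R) !natrM natrB // natrD natrM -/x -/y => T.
(* The 3 is made of 1 from [pr_ball_side2] and twice the 1 in [xP]. *)
have T2 : (x - y) * pr R E * L%:R <= d%:R * n.+1%:R * (3 + 2 ^+ d.+1 * M * t).
  rewrite mulrAC; apply: (@le_trans _ _ (d%:R * n.+1%:R * ((L ^ (2 * d))%:R + 2%:R * x) * pr R E)).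
    by rewrite ler_wpM2r // ltW.
  rewrite -mulrA ler_wpM2l ?mulr_ge0 //.
  have -> : 2 ^+ d.+1 * M * t = 2 * (2 ^+ d * (M * t)) by rewrite exprS -!mulrA.
  have := pr_ball_side2; rewrite mulrC mulrDl -mulrA; move: xP.
  move: (x * pr R E) (_ * pr R E) (_ * (M * t)) => u v w; lra.
rewrite -ler_pdivlMr // in T2.
have -> : 8 * d%:R * (3 + 2 ^+ d.+1 * M * t) * (n.+1%:R / L%:R) =
    8 * (d%:R * n.+1%:R * (3 + 2 ^+ d.+1 * M * t) / L%:R) by ring.
by rewrite ler_pM2l.
Qed.

(** If a tile fits, the tiles hold a fixed fraction of the positions, so that
    [s <= k * ((b * L) ^ d)%:R] and the law over the tiles gives the decay. Otherwise [t <= 7 * k],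
    and the factor [expR (7 * k)] makes the bound exceed 1. *)
Lemma no_occurs_tail (C0 k : R) : 0 <= C0 -> n.+1%:R <= C0 * L%:R ->
  k = (4 * (1 + C0)) ^+ d ->
  `|q - expR (- t)| <= expR (7 * k) * expR (- (k^-1 * t)).
Proof.
move=> C00 nL kE; have /andP[js1 js2] := js; have P0 := pr_ball_gt0; have r0 := rate_gt0.
have /andP[rM r7] := rate_bounds.
have k1 : 1 <= k by rewrite kE exprn_ege1 //; lra.
have k0 : 0 < k by apply: lt_le_trans k1.
have q0 : 0 <= q by rewrite subr_ge0 pr_le1.
have q1 : q <= 1 by rewrite gerBl pr_ge0.
have kt : k^-1 * t <= t by rewrite ler_piMl // invf_le1.
have et : expR (- t) <= expR (- (k^-1 * t)) by rewrite ler_expR lerN2.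
have e0 := expR_ge0 (- (k^-1 * t)).
have e7 : 1 <= expR (7 * k) by rewrite -expR0 ler_expR mulr_ge0 // ltW.
have Ln : (L + n)%:R <= (1 + C0) * L%:R.
  by rewrite natrD mulrDl mul1r lerD2l; apply: le_trans nL; rewrite ler_nat.
suff qb : q <= expR (7 * k) * expR (- (k^-1 * t)).
  have eb : expR (- t) <= expR (7 * k) * expR (- (k^-1 * t)).
    by apply: le_trans et _; rewrite ler_peMl.
  by have := expR_ge0 (- t); rewrite ler_norml => ?; apply/andP; split; lra.
have [jL|jL] := leqP (L + n) j.
  apply: (@le_trans _ _ (expR (- (k^-1 * t)))); last by rewrite ler_peMl.
  apply: le_trans q_le _; rewrite ler_expR lerN2 ler_pdivrMl // /t [leRHS]mulrCA.
  rewrite ler_wpM2l // natrX kE -exprMn.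
  apply: (le_trans (ltW js2)); rewrite natrX lerXn2r ?nnegrE ?mulr_ge0 //; try lra.
  have jb : (j.+1 <= 4 * b * (L + n))%N := ltn_divM4 (ltn_addr n L0) jL.
  rewrite natrM; apply: (@le_trans _ _ (4 * b%:R * (L + n)%:R)).
    by rewrite -!natrM ler_nat.
  have : b%:R * (L + n)%:R <= b%:R * ((1 + C0) * L%:R) :> R by rewrite ler_wpM2l.
  by lra.
apply: (le_trans q1); rewrite -expRD -[leLHS]expR0 ler_expR subr_ge0.
apply: le_trans kt _; rewrite /t.
have sk : s <= k * (L ^ d)%:R.
  apply: (le_trans (ltW js2)); rewrite kE natrX natrX -exprMn lerXn2r ?nnegrE ?mulr_ge0 //; try lra.
  apply: (@le_trans _ _ (L + n)%:R); first by rewrite ler_nat.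
  apply: (le_trans Ln); rewrite ler_wpM2r //; lra.
rewrite -mulrA; apply: ler_pM => //; [exact: ltW|exact: mulr_ge0 (ltW P0) s0|].
apply: (@le_trans _ _ (pr R E * (k * (L ^ d)%:R))); first by rewrite ler_pM2l.
rewrite mulrCA ler_piMr ?(ltW k0) //; apply: le_trans pr_ball_side _; lra.
Qed.

End Approximation.
End Rate.

(** * From finite cubes to the Bernoulli measure and the hitting time *)

Local Open Scope classical_set_scope.

Lemma Delta_dist (d n : nat) (a b : pattern d n) : Delta a b = dist a b.
Proof.
rewrite /Delta /dist -sum1dep_card [RHS]big_mkcond; apply: eq_bigr => y _.
by case: (a y); case: (b y).
Qed.

Section Bernoulli.
Variables (R : realType) (d : nat) (P : probability (Omega d) R).
Hypothesis hP : bernoulli_half P.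

(** The event is a finite disjoint union of cylinders, one for each configuration satisfying [E],
    and [hP] gives all of them the same mass. *)
Lemma bernoulli_law (S : finType) (h : S -> site d) (E : pred {ffun S -> bool}) :
  injective h ->
  P [set w : config d | E [ffun x => w (h x)]] = (pr R E)%:E.
Proof.
move=> hI.
pose cell (a : {ffun S -> bool}) : set (Omega d) :=
  [set w : config d | forall x, w (h x) = a x].
have mcell a : measurable (cell a).
  have -> : cell a = \bigcap_(x in [set: S]) [set w : config d | w (h x) = a x].
    by apply/seteqP; split=> w /= H x; [move=> _|]; apply: H.
  apply: fin_bigcap_measurable; first exact: finite_finset.
  by move=> x _; apply: sub_sigma_algebra; exists (h x), (a x).
have Pcell a : P (cell a) = ((2 ^+ #|S|)^-1)%:E.
  pose V : {fset site d} := [fset h x | x in enum S]%fset.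
  (* Off the range of [h] the value is a default; only the sites of [V] matter. *)
  pose b (y : site d) := if [pick x | h x == y] is Some x then a x else false.
  have bE x : b (h x) = a x.
    rewrite /b; case: pickP => [z /eqP/hI->//|/(_ x)]; by rewrite eqxx.
  have -> : cell a = [set w : config d | forall y, y \in V -> w y = b y].
    apply/seteqP; split=> w /= H.
      by move=> y /imfsetP[x _ ->] /=; rewrite bE.
    by move=> x; rewrite H ?bE //; apply: in_imfset => /=; rewrite mem_enum.
  rewrite hP exprVn card_imfset //= undup_id; last exact: enum_uniq.
  by rewrite -cardE.
have -> : [set w : config d | E [ffun x => w (h x)]] = \bigcup_(a in [set` E]) cell a.
  apply/seteqP; split=> w /=.
    by move=> Ew; exists [ffun x => w (h x)] => //= x; rewrite ffunE.
  move=> [a Ea H]; suff -> : [ffun x => w (h x)] = a by [].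
  by apply/ffunP => x; rewrite ffunE H.
rewrite measure_fin_bigcup //; last first.
  by move=> a b _ _ [w [/= wa wb]]; apply/ffunP => x; rewrite -wa wb.
rewrite -(@bigfs _ _ _ _ (index_enum {ffun S -> bool})); last 2 first.
- exact: index_enum_uniq.
- by move=> a _; rewrite mem_index_enum.
transitivity (\sum_(a : {ffun S -> bool} | E a) ((2 ^+ #|S|)^-1)%:E : \bar R)%E.
  by apply: eq_bigr => a _; exact: Pcell.
by rewrite sumEFin sumr_const /pr cardsE mulr_natl.
Qed.

End Bernoulli.

Definition cube_site (d M : nat) (x : cube d M) : site d := [ffun i => (x i : nat)%:Z].

Lemma cube_site_inj (d M : nat) : injective (@cube_site d M).
Proof.
move=> x y /ffunP e; apply/ffunP => i; apply/val_inj.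
by have := e i; rewrite !ffunE => -[].
Qed.

(** The hitting time takes values [(k.+1 ^ d)%:R], so exceeding [s0] means exceeding [j ^ d]: no
    occurrence lies in the box with [j] sites per direction. *)
Lemma hit_gt (R : realType) (d n j : nat) (A : pattern d n) (eps s0 : R)
    (E : pred (pattern d n)) (s : config d) :
  (0 < d)%N -> (0 < n)%N -> (forall a, approx_pat A eps a <-> E a) ->
  (j ^ d)%:R <= s0 < (j.+1 ^ d)%:R ->
  (s0%:E < hit A eps s)%E =
    ~~ @occurs d n E (j - n) [ffun x => s (cube_site x)].
Proof.
move=> d0 n0 EA /andP[js sj].
have restrE (x : cube d (j - n)) (z : site d) : (forall i, z i = (x i : nat)%:Z) ->
    restr n z s = pull (win x) [ffun x => s (cube_site x)].
  move=> zx; apply/ffunP => y; rewrite !ffunE; congr s.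
  by apply/ffunP => i; rewrite !ffunE zx PoszD.
apply/idP/idP => [sh|/existsPn noE].
  apply/existsPn => x; apply/negP => Ex.
  have xj : (x (Ordinal d0) < j - n)%N := ltn_ord _.
  suff : (hit A eps s <= (j ^ d)%:R%:E)%E.
    move=> /(lt_le_trans sh); rewrite lte_fin => /lt_le_trans /(_ js).
    by rewrite ltxx.
  (* The box of index [k] has [k.+1] sites per direction, whence [j.-1]; it is positive because a
     window with [n.+1 > 1] sites per direction fits in it. *)
  apply: ereal_inf_lbound; exists j.-1; last by rewrite /card_box prednK //; lia.
  split; first by lia.
  exists (cube_site x); split; last first.
    by apply/EA; rewrite (restrE x) // => i; rewrite ffunE.
  move=> y i; rewrite !ffunE; have := ltn_ord (x i); have := ltn_ord (y i).
  by move: (val (x i)) (val (y i)) => /= a b; lia.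
apply: (@lt_le_trans _ _ (j.+1 ^ d)%:R%:E); first by rewrite lte_fin.
apply: le_ereal_inf_tmp => _ [k [k0 [x [xk Ax]]] <-]; rewrite lee_fin ler_nat /card_box.
rewrite leq_exp2r //; rewrite leqNgt; apply/negP => kj.
(* The two extreme corners of the window confine its position. *)
have x0 i : 0 <= x i.
  by have [+ _] := xk [ffun=> ord0] i; rewrite !ffunE /= addr0.
have xn i : x i + n%:Z <= k%:Z.
  by have [_] := xk [ffun=> ord_max] i; rewrite !ffunE.
have xlt i : (`|x i| < j - n)%N by have := x0 i; have := xn i; lia.
have := noE [ffun i => Ordinal (xlt i)].
rewrite -(restrE _ x); last by move=> i; rewrite ffunE /= gez0_abs.
by move/negP; apply; apply/EA.
Qed.

Lemma exists_floor_root (R : realType) (d : nat) (s : R) : (0 < d)%N -> 0 <= s ->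
  exists j : nat, (j ^ d)%:R <= s < (j.+1 ^ d)%:R.
Proof.
move=> d0 s0.
have ex : exists j, ((j ^ d)%:R <= s) by exists 0%N; rewrite exp0n.
have ub j : (j ^ d)%:R <= s -> (j <= Num.truncn s)%N.
  move=> js; rewrite truncn_ge_nat //; apply: le_trans js; rewrite ler_nat.
  by case: j => // j; rewrite -{1}(expn1 j.+1) leq_pexp2l.
case: (ex_maxnP ex ub) => j js jmax; exists j; rewrite js /=.
rewrite ltNge; apply/negP => /jmax; by rewrite ltnn.
Qed.

Section HittingProbability.
Variables (R : realType) (d : nat) (P : probability (Omega d) R) (eps : R).
Hypotheses (d2 : (2 <= d)%N) (hP : bernoulli_half P).
Hypothesis eps_bounds : 0 < eps < growth_ratio.+1%:R^-1.

Definition radius (n : nat) : nat := Num.truncn (eps * (card_box d n)%:R).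

Let eps0 : 0 < eps. Proof. by have /andP[] := eps_bounds. Qed.

Lemma radius_le n : (growth_ratio.+1 * radius n <= n.+1 ^ d)%N.
Proof.
have N0 : 0 <= eps * (card_box d n)%:R by rewrite mulr_ge0 // ltW.
have /andP[h _] := truncn_itv N0; have /andP[_ e1] := eps_bounds.
rewrite -(ler_nat R) natrM -ler_pdivlMl ?ltr0n //; apply: le_trans h _.
by rewrite ler_wpM2r // ltW.
Qed.

Lemma approx_patE n (A a : pattern d n) :
  approx_pat A eps a <-> (dist a A <= radius n)%N.
Proof. by rewrite /radius truncn_ge_nat ?mulr_ge0 ?(ltW eps0) // -Delta_dist. Qed.

Lemma prob_approx_set n (A : pattern d n) :
  fine (P (approx_set A eps)) = pr R (fun a => (dist a A <= radius n)%N).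
Proof.
rewrite (_ : approx_set A eps =
    [set w | (dist [ffun x => w (shift_pt (origin d) x)] A <= radius n)%N]).
  rewrite (bernoulli_law hP (fun a : pattern d n => (dist a A <= radius n)%N)) //.
  move=> x y /ffunP e; apply/ffunP => i; apply/val_inj.
  by have := e i; rewrite !ffunE !add0r => -[].
by apply/seteqP; split=> w /approx_patE.
Qed.

Lemma prob_hit_gt n (A : pattern d n) (j : nat) (s : R) : (0 < n)%N ->
  (j ^ d)%:R <= s < (j.+1 ^ d)%:R ->
  P [set w : config d | (s%:E < hit A eps w)%E] =
    (1 - pr R (@occurs d n (fun a => (dist a A <= radius n)%N) (j - n)))%:E.
Proof.
move=> n0 js; rewrite -pr_not -(bernoulli_law hP _ (@cube_site_inj d (j - n + n))).
congr (P _); apply/seteqP; split=> w /=;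
  by rewrite (hit_gt w (ltnW d2) n0 (approx_patE A) js).
Qed.

End HittingProbability.

Theorem theorem2p8 (R : realType) (d : nat) (hd : (2 <= d)%N)
  (P Q : probability (Omega d) R)
  (hP : bernoulli_half P)
  (hQs : stationary Q) (hQe : ergodic Q) (hQg : gibbs Q)
  (eps0 : R)
  (hRD : forall e : R, 0 <= e < eps0 ->
     cvgn (rate_distortion_n Q P e) /\ 0 < rate_distortion Q P e) :
  forall alpha : R, 0 < alpha < 1 ->
  exists eps1 : R, 0 < eps1 /\
  forall eps : R, 0 < eps < eps1 -> eps / alpha < eps0 ->
  exists L1 L2 C c K : R,
    [/\ 0 < L1, 0 < L2, 0 < C, 0 < c & 0 < K] /\
    exists Lam : forall n : nat, pattern d n -> R,
      (forall (n : nat) (A : pattern d n), L1 <= Lam n A <= L2) /\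
      forall t : R, 0 < t -> forall n : nat, (1 <= n)%N ->
        {ae Q, forall w : Omega d,
          let A := restr n (origin d) w in
          (`| P [set s : config d |
                 ((t / (Lam n A * fine (P (approx_set A eps))))%:E < hit A eps s)%E]
              - (expR (- t))%:E | <=
           (C * expR (- (c * t)) * expR (- (K * (n ^ d)%:R)))%:E)%E}.
Proof.
(* Below this threshold [radius_le] holds, which is the smallness condition of [pr_overlap]. *)
move=> alpha _; exists growth_ratio.+1%:R^-1; split; first by rewrite invr_gt0 ltr0n.
move=> eps heps _.
have dp : 0 < d%:R :> R by rewrite ltr0n ltnW.
pose M : R := overlap_bound R d.
(* [C0] is the constant of [side_ge], [k] the time scale of [no_occurs_tail], [Z] the prefactor of
   [no_occurs_approx] once [n.+1 / side] is bounded, and [C] the resulting constant of [exp_approx]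
   at the rate [k^-1]. *)
pose C0 : R := 160 * d%:R.
pose k : R := (4 * (1 + C0)) ^+ d.
pose Z : R := 8 * d%:R * (3 + 2 ^+ d.+1 * M) * C0.
pose C : R := 1 + Z * expR (7 * k) * (1 + 2 / k^-1).
have M0 : 0 < M := overlap_bound_gt0 R d.
have C00 : 0 < C0 by rewrite mulr_gt0.
have k0 : 0 < k by rewrite exprn_gt0 // mulr_gt0 // addr_gt0.
have Z0 : 0 <= Z.
  by rewrite !mulr_ge0 ?(ltW C00) // addr_ge0 // mulr_ge0 ?exprn_ge0 // ltW.
have c0 : 0 < k^-1 by rewrite invr_gt0.
have C1 : 0 < C.
  apply: ltr_pwDl => //; apply: mulr_ge0; first exact: mulr_ge0 Z0 (expR_ge0 _).
  by rewrite addr_ge0 // divr_ge0 // ltW.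
exists M^-1, 7, C, (k^-1 / 4), C0^-1; split; first by split; rewrite ?invr_gt0 ?divr_gt0.
exists (fun n A => rate R (radius d eps n) A); split.
  by move=> n A; have := rate_bounds R A hd (radius_le d heps n).
move=> t t0 n n1; apply: aeW => w; cbv zeta; set A := restr n (origin d) w.
rewrite (prob_approx_set hP heps); set r := radius d eps n.
have rd : (growth_ratio.+1 * r <= n.+1 ^ d)%N := radius_le d heps n.
set lam := rate R r A; set PA := pr R _.
have lam0 : 0 < lam := rate_gt0 R A hd rd.
have PA0 : 0 < PA := pr_ball_gt0 R r A.
set s := t / (lam * PA).
have s0 : 0 <= s := divr_ge0 (ltW t0) (ltW (mulr_gt0 lam0 PA0)).
have tE : lam * PA * s = t by rewrite /s mulrC divfK // gt_eqF // mulr_gt0.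
have [j js] := exists_floor_root (ltnW hd) s0.
rewrite (prob_hit_gt hd hP heps A n1 js) -EFinB abse_EFin lee_fin.
have nL := side_ge R n hd; rewrite -/C0 in nL.
have e2 : expR (- (2 * (C0^-1 * (n ^ d)%:R))) <= 1 :> R.
  by rewrite -[leRHS]expR0 ler_expR oppr_le0 !mulr_ge0 // invr_ge0 ltW.
have L0 : 0 < (side d n)%:R :> R by rewrite ltr0n side_gt0.
have nL1 : n.+1%:R <= C0 * (side d n)%:R.
  by apply: le_trans nL _; rewrite ler_pM2r // ler_piMr // ltW.
apply: (exp_approx (a := expR (7 * k)) (Z := Z) (ltW t0)) => //.
- have := no_occurs_approx A hd rd js; rewrite -/lam -/PA tE -/M => h.
  apply: le_trans h _; rewrite -ler_pdivrMr // in nL.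
  have h3 : 3 + 2 ^+ d.+1 * M * t <= (3 + 2 ^+ d.+1 * M) * (1 + t).
    have : 0 <= 2 ^+ d.+1 * M by rewrite mulr_ge0 ?exprn_ge0 // ltW.
    by move: (2 ^+ d.+1 * M) => u u0; rewrite mulrDr mulr1 mulrDl; lra.
  have q0 : 0 <= n.+1%:R / (side d n)%:R :> R by rewrite divr_ge0.
  have -> : Z * (1 + t) * expR (- (2 * (C0^-1 * (n ^ d)%:R))) =
    8 * d%:R * ((3 + 2 ^+ d.+1 * M) * (1 + t)) * (C0 * expR (- (2 * (C0^-1 * (n ^ d)%:R)))).
    by rewrite /Z; ring.
  apply: ler_pM => //.
    by rewrite !mulr_ge0 // addr_ge0 // !mulr_ge0 ?exprn_ge0 // ltW.
  by rewrite ler_wpM2l // mulr_ge0.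
- have := no_occurs_tail A hd rd js (ltW C00) nL1 (erefl k).
  by rewrite -/lam -/PA tE.
Qed.
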